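(* Suppose that $\mu\in\mathcal M(\mathbb R^d)$ is smooth at its halfspace median set $D^*(\mu)$. Then $$\left(\operatorname{int}(D^*(\mu))\right)^{\mathsf c}=\bigcup\{H\in\mathcal H(D^*(\mu)):\mu(H)=\alpha^*(\mu)\}.$$ If, in addition, $\mu$ has contiguous support at $D^*(\mu)$, then for every $x\in D^*(\mu)$ $$\mathbb R^d=\bigcup\{H\in\mathcal H(x):\mu(H)=D(x;\mu)\}.$$
   Context: $\mathcal M(\mathbb R^d)$ is the set of finite Borel measures on $\mathbb R^d$. $\mathcal H$ is the set of closed halfspaces $H_{x,u}=\{y\in\mathbb R^d:\langle x,u\rangle\le\langle y,u\rangle\}$, $x\in\mathbb R^d$, $u\in\mathbb S^{d-1}$; $\mathcal H(x)=\{H_{x,u}:u\in\mathbb S^{d-1}\}$. $A^{\mathsf c}=\mathbb R^d\setminus A$; $\operatorname{int},\operatorname{cl},\operatorname{bd}$ denote interior, closure, boundary. Halfspace depth: $D(x;\mu)=\inf_{H\in\mathcal H(x)}\mu(H)$; $D_\alpha(\mu)=\{x:D(x;\mu)\ge\alpha\}$; $\alpha^*(\mu)=\sup\{\alpha\in\mathbb R:D_\alpha(\mu)\ne\emptyset\}$; the halfspace median set is $D^*(\mu)=D_{\alpha^*(\mu)}(\mu)$. Touching halfspaces: for a non-empty convex set $A$, $\mathcal H(A)=\{H\in\mathcal H:H\cap\operatorname{cl}(A)\neq\emptyset,\ \operatorname{int}(H)\cap A=\emptyset\}$. For a convex proper subset $A\subsetneq\mathbb R^d$: $\mu$ is smooth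 at $A$ if $\mu(\operatorname{bd}(H))=0$ for all $H\in\mathcal H(A)$; $\mu$ has contiguous support at $A$ if for each $H'\in\mathcal H(A)$ and each $H\in\mathcal H$ with $H'\subsetneq H$, $\operatorname{bd}(H)\cap\operatorname{int}(A)\neq\emptyset$ implies $\mu(H')<\mu(H)$. (These conditions are only defined for proper subsets of $\mathbb R^d$.) *)

(* Defs.v *)
From HB Require Import structures.
From mathcomp Require Import all_boot all_order all_algebra.
From mathcomp Require Import all_classical all_reals all_analysis.

Set Implicit Arguments.
Unset Strict Implicit.
Unset Printing Implicit Defensive.

Import Order.TTheory GRing.Theory Num.Theory.
Import numFieldNormedType.Exports.

Local Open Scope classical_set_scope.
Local Open Scope ring_scope.

(* The topology on ['rV[R]_d] is the library's (product) topology, which is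
   the Euclidean one; the library has no measurable structure on ['rV[R]_d],
   so we take the sigma-algebra generated by the open sets. *)
Definition borelRd (R : realType) (d : nat) :
    measurableType (sigma_display (@open 'rV[R]_d)) :=
  g_sigma_algebraType (@open 'rV[R]_d).

Definition dotp (R : realType) (d : nat) (x y : 'rV[R]_d) : R :=
  \sum_(i < d) x ord0 i * y ord0 i.

(* The library norm on ['rV[R]_d] is the sup norm, hence this one. *)
Definition enorm (R : realType) (d : nat) (x : 'rV[R]_d) : R :=
  Num.sqrt (dotp x x).

Definition unit_sphere (R : realType) (d : nat) : set 'rV[R]_d :=
  [set u | enorm u = 1].

Definition boundary (T : topologicalType) (A : set T) : set T :=
  closure A `\` interior A.

Definition halfspace (R : realType) (d : nat) (x u : 'rV[R]_d) :
    set 'rV[R]_d :=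
  [set y | dotp x u <= dotp y u].

Definition halfspaces (R : realType) (d : nat) : set (set 'rV[R]_d) :=
  [set H | exists x u, unit_sphere u /\ H = halfspace x u].

Definition halfspaces_at (R : realType) (d : nat) (x : 'rV[R]_d) :
    set (set 'rV[R]_d) :=
  [set H | exists u, unit_sphere u /\ H = halfspace x u].

Definition depth (R : realType) (d : nat)
    (mu : {finite_measure set (borelRd R d) -> \bar R}) (x : 'rV[R]_d) :
    \bar R :=
  ereal_inf [set mu H | H in halfspaces_at x].

(* The level ranges over [\bar R] only so that the region can be taken at
   [max_depth mu], which is computed as an extended real. *)
Definition depth_region (R : realType) (d : nat)
    (mu : {finite_measure set (borelRd R d) -> \bar R}) (a : \bar R) :
    set 'rV[R]_d :=
  [set x | (a <= depth mu x)%E].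

Definition max_depth (R : realType) (d : nat)
    (mu : {finite_measure set (borelRd R d) -> \bar R}) : \bar R :=
  ereal_sup [set a%:E | a in [set a : R | depth_region mu a%:E !=set0]].

Definition median_set (R : realType) (d : nat)
    (mu : {finite_measure set (borelRd R d) -> \bar R}) : set 'rV[R]_d :=
  depth_region mu (max_depth mu).

(* Intended for non-empty convex [A]. *)
Definition touching_halfspaces (R : realType) (d : nat) (A : set 'rV[R]_d) :
    set (set 'rV[R]_d) :=
  [set H | [/\ halfspaces H, H `&` closure A !=set0 &
               interior H `&` A = set0]].

(* Smoothness and contiguity of the support are notions about convex proper
   subsets of the space; properness is part of the definitions, convexity is
   left to the sets they are applied to (median sets are always convex). *)
Definition smooth_at (R : realType) (d : nat)
    (mu : {finite_measure set (borelRd R d) -> \bar R}) (A : set 'rV[R]_d) :=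
  A `<` [set: 'rV[R]_d] /\
  forall H, touching_halfspaces A H -> mu (boundary H) = 0%E.

Definition contiguous_support_at (R : realType) (d : nat)
    (mu : {finite_measure set (borelRd R d) -> \bar R}) (A : set 'rV[R]_d) :=
  A `<` [set: 'rV[R]_d] /\
  forall H' H, touching_halfspaces A H' -> halfspaces H -> H' `<` H ->
    boundary H `&` interior A !=set0 -> (mu H' < mu H)%E.

(* Main.v *)
Require Import Defs.
From mathcomp Require Import all_boot all_order all_algebra.
From mathcomp Require Import all_classical all_reals all_analysis.
From mathcomp Require Import ring lra.

(** A point just outside the median set M lies on the boundary of a halfspace
    of mass below the maximal depth, and such a halfspace misses M altogether,
    since a point of M inside it would be too shallow.  Let such outside points
    tend to a point b of M, seen from b in directions tending to w.
    The unit normals of these light halfspaces accumulate, the sphere being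
    compact, and an accumulation point u gives a closed halfspace with b on its
    boundary whose interior still misses M and still has mass at most the
    maximal depth, because the mass of open halfspaces is lower semicontinuous
    in the boundary point and the normal.  As b itself is missed by the light
    halfspaces, their normals make acute angles with those directions, so
    that 0 <= <w, u> in the limit ([supporting_light_halfspace]).  Smoothness
    makes the boundary of the limit halfspace massless, hence its mass is at
    most the maximal depth; it is at least that because it contains b
    ([touching_halfspace_max_depth]).

    First claim: if x is not interior to M, take for b the last point of M on a
    segment from M to x (or x itself if it lies in M) and for w the direction
    x - b.  Then 0 <= <x - b, u> says that the limit halfspace contains x.
    Conversely, a touching halfspace misses the interior of M, since a point
    common to both could be moved into the interior of the halfspace without
    leaving M.

    Second claim: contiguous support forces M to have empty interior
    ([interior_median_set_contiguous]).  At an interior point x some open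
    halfspace with x on its boundary has mass at most the depth of x; pushing it
    until it touches M strictly decreases its mass, so the touching halfspace
    has mass below the maximal depth although it contains a point of M.  Once M
    has no interior, every direction at every x in M approximately leaves M at
    once, so the limit argument applies with b = x and w = y - x for an
    arbitrary y, and produces a halfspace at x of minimal mass containing y.

    That M is nonempty and compact comes from upper semicontinuity of the depth
    and from its decay at infinity. *)

Set Implicit Arguments.
Unset Strict Implicit.
Unset Printing Implicit Defensive.

Import Order.TTheory GRing.Theory Num.Theory.
Import numFieldNormedType.Exports.

Local Open Scope classical_set_scope.
Local Open Scope ring_scope.

(** * The inner product and the unit sphere *)

Lemma dotpDl (R : realType) (d : nat) (x y u : 'rV[R]_d) :
  dotp (x + y) u = dotp x u + dotp y u.
Proof. by rewrite -big_split; apply: eq_bigr => i _; rewrite mxE mulrDl. Qed.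

Lemma dotpZl (R : realType) (d : nat) (t : R) (x u : 'rV[R]_d) :
  dotp (t *: x) u = t * dotp x u.
Proof.
by rewrite /dotp mulr_sumr; apply: eq_bigr => i _; rewrite mxE mulrA.
Qed.

Lemma dotpBl (R : realType) (d : nat) (x y u : 'rV[R]_d) :
  dotp (x - y) u = dotp x u - dotp y u.
Proof. by rewrite -scaleN1r dotpDl dotpZl mulN1r. Qed.

Lemma dotp_continuous (R : realType) (d : nat) :
  continuous (fun p : 'rV[R]_d * 'rV[R]_d => dotp p.1 p.2).
Proof.
move=> p; have := @cvg_big R 'I_d +%R 0 predT (@add_continuous R^o) _ (nbhs p)
  (index_enum 'I_d) (fun i q => q.1 ord0 i * q.2 ord0 i)
  (fun i => p.1 ord0 i * p.2 ord0 i).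
apply=> i _; apply: cvgM.
  apply: (cvg_comp fst (fun x : 'rV[R]_d => x ord0 i) cvg_fst).
  exact: coord_continuous.
apply: (cvg_comp snd (fun x : 'rV[R]_d => x ord0 i) cvg_snd).
exact: coord_continuous.
Qed.

Lemma cvg_dotp (R : realType) (d : nat) (T : Type) (F : set_system T)
    (FF : Filter F) (f g : T -> 'rV[R]_d) (x u : 'rV[R]_d) :
  f @ F --> x -> g @ F --> u -> dotp (f i) (g i) @[i --> F] --> dotp x u.
Proof.
move=> fx gu.
have c : {for (x, u), continuous (fun p : 'rV[R]_d * 'rV[R]_d => dotp p.1 p.2)}.
  exact: dotp_continuous.
exact: (cvg_comp (fun i => (f i, g i)) (fun p => dotp p.1 p.2)
  (cvg_pair fx gu) c).
Qed.

Lemma dotp_continuousl (R : realType) (d : nat) (u : 'rV[R]_d) :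
  continuous (fun x : 'rV[R]_d => dotp x u).
Proof.
move=> x; apply: (@cvg_dotp R d _ (nbhs x) _ id (fun=> u)).
  exact: cvg_id.
exact: cvg_cst.
Qed.

Lemma near_dotp_lt (R : realType) (d : nat) (T : Type) (F : set_system T)
    (FF : Filter F) (f g f' g' : T -> 'rV[R]_d) (x u x' u' : 'rV[R]_d) :
  f @ F --> x -> g @ F --> u -> f' @ F --> x' -> g' @ F --> u' ->
  dotp x u < dotp x' u' ->
  \forall i \near F, dotp (f i) (g i) < dotp (f' i) (g' i).
Proof.
move=> fx gu fx' gu'; rewrite -subr_gt0 => lt0.
have c := cvgB (cvg_dotp FF fx' gu') (cvg_dotp FF fx gu).
have := cvgr_gt _ (c FF) _ lt0.
by move=> H; near=> i; rewrite -subr_gt0; near: i; exact: H.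
Unshelve. all: by end_near.
Qed.

Lemma mx_norm_le (R : realType) (d : nat) (x : 'rV[R]_d) (M : R) :
  0 <= M -> (forall i, `|x ord0 i| <= M) -> `|x| <= M.
Proof.
move=> M0 xM; rewrite /Num.norm /= mx_normrE; apply/bigmax_leP; split => //=.
by move=> [i j] _ /=; rewrite ord1.
Qed.

Lemma unit_sphereE (R : realType) (d : nat) (u : 'rV[R]_d) :
  unit_sphere u <-> dotp u u = 1.
Proof.
rewrite /unit_sphere /= /enorm; split; last by move=> ->; rewrite sqrtr1.
move=> h; rewrite -[LHS]sqr_sqrtr ?h ?expr1n//.
by apply: sumr_ge0 => i _; rewrite -expr2 sqr_ge0.
Qed.

Lemma compact_sphere (R : realType) (d : nat) : compact (@unit_sphere R d).
Proof.
apply: bounded_closed_compact.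
  exists 1; split; first exact: num_real.
  move=> M M1 u /unit_sphereE uu.
  apply: mx_norm_le => [|i]; first by rewrite (le_trans ler01)// ltW.
  apply: le_trans (ltW M1).
  have : `|u ord0 i| ^+ 2 <= 1.
    rewrite -uu /dotp (bigD1 i)//= real_normK ?num_real// -expr2 lerDl.
    by apply: sumr_ge0 => j _; rewrite -expr2 sqr_ge0.
  by rewrite expr_le1.
have -> : @unit_sphere R d = (fun u => dotp u u) @^-1` [set 1].
  by apply/seteqP; split=> u /unit_sphereE.
apply: closed_comp => [u _|]; last exact: closed_eq.
by apply: (@cvg_dotp R d _ (nbhs u) _ id id); exact: cvg_id.
Qed.

(** * Halfspaces *)

Definition open_halfspace (R : realType) (d : nat) (x u : 'rV[R]_d) :
    set 'rV[R]_d :=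
  [set y | dotp x u < dotp y u].

Lemma closed_dotp_ge (R : realType) (d : nat) (u : 'rV[R]_d) (c : R) :
  closed [set y : 'rV[R]_d | c <= dotp y u].
Proof.
apply: (@closed_comp _ _ (fun y => dotp y u) [set r | c <= r]).
  by move=> y _; exact: dotp_continuousl.
exact: closed_ge.
Qed.

Lemma closed_halfspace (R : realType) (d : nat) (x u : 'rV[R]_d) :
  closed (halfspace x u).
Proof. exact: closed_dotp_ge. Qed.

Lemma halfspacexx (R : realType) (d : nat) (x u : 'rV[R]_d) :
  halfspace x u x.
Proof. exact: lexx. Qed.

Lemma open_open_halfspace (R : realType) (d : nat) (x u : 'rV[R]_d) :
  open (open_halfspace x u).
Proof.
apply: (@open_comp _ _ (fun y => dotp y u) [set r | dotp x u < r]).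
  by move=> y _; exact: dotp_continuousl.
exact: open_gt.
Qed.

Lemma line_cvg (R : realType) (d : nat) (x v : 'rV[R]_d) :
  x + t *: v @[t --> 0^'+] --> x.
Proof.
rewrite -[X in _ --> X]addr0 -(scale0r v).
apply: cvgD; first exact: cvg_cst.
by apply: cvgZr_tmp; apply: cvg_at_right_filter; exact: cvg_id.
Qed.

Lemma interior_halfspace (R : realType) (d : nat) (x u : 'rV[R]_d) :
  unit_sphere u -> interior (halfspace x u) = open_halfspace x u.
Proof.
move=> /unit_sphereE uu; apply/seteqP; split; last first.
  rewrite -open_subsetE; last exact: open_open_halfspace.
  by move=> z /ltW.
move=> y yH; have yuH := line_cvg (- u) yH.
have [t [t0 ytH]] : exists t, 0 < t /\ halfspace x u (y + t *: (- u)).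
  near (0 : R)^'+ => t; exists t; split; first by [].
  by near: t; exact: yuH.
move: ytH; rewrite /halfspace /open_halfspace/=.
rewrite dotpDl dotpZl -scaleN1r dotpZl uu.
by lra.
Unshelve. all: by end_near.
Qed.

Lemma measurable_open_borel (R : realType) (d : nat) (A : set (borelRd R d)) :
  open (A : set 'rV[R]_d) -> measurable A.
Proof. by move=> oA; exact: sub_gen_smallest. Qed.

Lemma measurable_closed_borel (R : realType) (d : nat) (A : set (borelRd R d)) :
  closed (A : set 'rV[R]_d) -> measurable A.
Proof.
move=> cA; rewrite -[A]setCK; apply: measurableC.
by apply: measurable_open_borel; exact: closed_openC.
Qed.

Lemma measurable_halfspace (R : realType) (d : nat) (x u : 'rV[R]_d) :
  measurable (halfspace x u : set (borelRd R d)).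
Proof. by apply: measurable_closed_borel; exact: closed_halfspace. Qed.

Lemma measurable_open_halfspace (R : realType) (d : nat) (x u : 'rV[R]_d) :
  measurable (open_halfspace x u : set (borelRd R d)).
Proof. by apply: measurable_open_borel; exact: open_open_halfspace. Qed.

(** * Semicontinuity of the mass of halfspaces and of the depth *)

Lemma near_ereal_gt (R : realType) (T : Type) (F : set_system T)
    (FF : Filter F) (f : T -> \bar R) (l a : \bar R) :
  f @ F --> l -> (a < l)%E -> \forall i \near F, (a < f i)%E.
Proof.
move=> fl al; apply: (fl [set r | (a < r)%E]).
by apply: open_nbhs_nbhs; split => //; exact: open_ereal_gt_ereal.
Qed.

Lemma near_ereal_lt (R : realType) (T : Type) (F : set_system T)
    (FF : Filter F) (f : T -> \bar R) (l a : \bar R) :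
  f @ F --> l -> (l < a)%E -> \forall i \near F, (f i < a)%E.
Proof.
move=> fl al; apply: (fl [set r | (r < a)%E]).
by apply: open_nbhs_nbhs; split => //; exact: open_ereal_lt_ereal.
Qed.

Lemma bounded_ball0 (R : realType) (d : nat) (A : set 'rV[R]_d) (M : R) :
  (forall x, A x -> `|x| <= M) -> bounded_set A.
Proof.
move=> AM; exists M; split; first exact: num_real.
by move=> N MN x /AM xM; exact: le_trans xM (ltW MN).
Qed.

Lemma closed_norm_le (R : realType) (d : nat) (M : R) :
  closed [set x : 'rV[R]_d | `|x| <= M].
Proof.
apply: (@closed_comp _ _ (fun x : 'rV[R]_d => `|x|) [set r | r <= M]).
  by move=> x _; exact: norm_continuous.
exact: closed_le.
Qed.

(** The open halfspace is exhausted by compact sets K n, one of which already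
    has mass above a; by compactness all halfspaces near the given one contain
    that K n. *)
Lemma open_halfspace_measure_lsc (R : realType) (d : nat)
    (mu : {finite_measure set (borelRd R d) -> \bar R}) (b u : 'rV[R]_d)
    (a : \bar R) :
  (a < mu (open_halfspace b u))%E ->
  \forall p \near (b, u), (a < mu (halfspace p.1 p.2))%E.
Proof.
move=> aH.
(* The margin n.+1^-1 keeps K n off the boundary hyperplane, hence makes it
   closed; the bound on the norm makes it compact. *)
pose K n : set 'rV[R]_d := [set y | dotp b u + n.+1%:R^-1 <= dotp y u] `&`
                           [set y | `|y| <= n%:R].
have clK n : closed (K n).
  by apply: closedI; [exact: closed_dotp_ge|exact: closed_norm_le].
have mK n : measurable (K n : set (borelRd R d)).
  exact: measurable_closed_borel.
have KE : \bigcup_n K n = open_halfspace b u.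
  apply/seteqP; split=> [y [n _ [yn _]]|y by_].
    by apply: lt_le_trans yn; rewrite ltrDl.
  have e0 : 0 < dotp y u - dotp b u by rewrite subr_gt0.
  near \oo => n; exists n => //; split => /=.
    rewrite -lerBrDl ltW//.
    by near: n; exact: (near_infty_natSinv_lt (PosNum e0)).
  by near: n; exact: nbhs_infty_ger.
have ndK : nondecreasing_seq K.
  move=> m n mn; apply/subsetPset => y [yu yn]; split; rewrite /=.
    by apply: le_trans yu; rewrite lerD2l lef_pV2 ?posrE// ler_nat.
  by apply: le_trans yn _; rewrite ler_nat.
have muK : mu \o K @ \oo --> mu (open_halfspace b u).
  rewrite -KE; apply: nondecreasing_cvg_mu => //.
  by rewrite KE; exact: measurable_open_halfspace.
have [n an] : exists n, (a < mu (K n))%E.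
  near \oo => n; exists n.
  by near: n; exact: near_ereal_gt muK aH.
have : near_covering (K n).
  apply/compact_near_coveringP; apply: bounded_closed_compact => //.
  by apply: (@bounded_ball0 _ _ _ n%:R) => y [].
move=> /(_ _ (nbhs (b, u)) (fun p => open_halfspace p.1 p.2)) Kn.
have {}Kn : \forall p \near (b, u), K n `<=` open_halfspace p.1 p.2.
  apply: Kn => y [yu _].
  apply: (@near_dotp_lt R d _ (filter_prod (nbhs y) (nbhs (b, u))) _
    (fun q => q.2.1) (fun q => q.2.2) fst (fun q => q.2.2) b u y u).
  - exact: (cvg_comp snd fst cvg_snd cvg_fst).
  - exact: (cvg_comp snd snd cvg_snd cvg_snd).
  - exact: cvg_fst.
  - exact: (cvg_comp snd snd cvg_snd cvg_snd).
  - by apply: lt_le_trans yu; rewrite ltrDl.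
apply: filterS Kn => p Kp; apply: lt_le_trans an _.
apply: le_measure; rewrite ?inE//.
- exact: measurable_halfspace.
- by move=> y /Kp /ltW.
Unshelve. all: by end_near.
Qed.

Lemma depth_le_halfspace (R : realType) (d : nat)
    (mu : {finite_measure set (borelRd R d) -> \bar R}) (x z u : 'rV[R]_d) :
  unit_sphere u -> halfspace x u z -> (depth mu z <= mu (halfspace x u))%E.
Proof.
move=> uu xz; apply: (@le_trans _ _ (mu (halfspace z u))).
  by apply: ereal_inf_lbound; exists (halfspace z u) => //; exists u.
apply: le_measure; rewrite ?inE.
- exact: measurable_halfspace.
- exact: measurable_halfspace.
- by move=> y; exact: le_trans.
Qed.

Lemma depth_lt (R : realType) (d : nat)
    (mu : {finite_measure set (borelRd R d) -> \bar R}) (x : 'rV[R]_d)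
    (a : \bar R) :
  (depth mu x < a)%E ->
  exists2 u, unit_sphere u & (mu (halfspace x u) < a)%E.
Proof. by case/ereal_inf_lt => _ [_ [u [uu ->]] <-] ?; exists u. Qed.

(** A halfspace at x of mass below a keeps mass below a when its boundary is
    pushed slightly outwards, and then it contains the parallel halfspaces at
    all points near x. *)
Lemma depth_usc (R : realType) (d : nat)
    (mu : {finite_measure set (borelRd R d) -> \bar R}) (x : 'rV[R]_d)
    (a : \bar R) :
  (depth mu x < a)%E -> \forall y \near x, (depth mu y < a)%E.
Proof.
case/depth_lt => u uu ua.
pose E n : set 'rV[R]_d := [set y | dotp x u - n.+1%:R^-1 <= dotp y u].
have mE n : measurable (E n : set (borelRd R d)).
  by apply: measurable_closed_borel; exact: closed_dotp_ge.
have EE : \bigcap_n E n = halfspace x u.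
  apply/seteqP; split=> [y Ey|y xy n _]; last first.
    by apply: le_trans xy; rewrite gerBl.
  rewrite /halfspace/=; apply/ler_addgt0Pr => e e0.
  near \oo => n; rewrite -lerBlDr; apply: le_trans (Ey n I).
  rewrite lerD2l lerN2 ltW//.
  by near: n; exact: (near_infty_natSinv_lt (PosNum e0)).
have niE : nonincreasing_seq E.
  move=> m n mn; apply/subsetPset => y; apply: le_trans.
  by rewrite lerD2l lerN2 lef_pV2 ?posrE// ler_nat.
have muE : mu \o E @ \oo --> mu (halfspace x u).
  rewrite -EE; apply: nonincreasing_cvg_mu => //.
    by rewrite ltey_eq fin_num_measure.
  by rewrite EE; exact: measurable_halfspace.
have [n an] : exists n, (mu (E n) < a)%E.
  near \oo => n; exists n.
  by near: n; exact: near_ereal_lt muE ua.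
have : \forall y \near x, dotp x u - n.+1%:R^-1 < dotp y u.
  apply: (cvgr_gt _ (@dotp_continuousl R d u x)).
  by rewrite gtrBl.
apply: filterS => y xy; apply: le_lt_trans an.
apply: le_trans (@depth_le_halfspace _ _ mu y y u uu (halfspacexx y u)) _.
apply: le_measure; rewrite ?inE//.
- exact: measurable_halfspace.
- by move=> z; apply: le_trans; exact: ltW.
Unshelve. all: by end_near.
Qed.

(** * Depth regions and the median set *)

Lemma closed_depth_region (R : realType) (d : nat)
    (mu : {finite_measure set (borelRd R d) -> \bar R}) (a : \bar R) :
  closed (depth_region mu a).
Proof.
have -> : depth_region mu a = ~` [set x | (depth mu x < a)%E].
  by apply/seteqP; split=> x; rewrite /depth_region /= leNgt => /negP.
apply: open_closedC; rewrite openE => x xa; exact: depth_usc.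
Qed.

Lemma coord_norm_le (R : realType) (d : nat) (x : 'rV[R]_d) i :
  `|x ord0 i| <= `|x|.
Proof.
rewrite [leRHS]/Num.norm /= mx_normrE; apply/bigmax_geP; right => /=.
by exists (ord0, i).
Qed.

(** The mass of the complement of a large ball tends to 0, and a point far away
    is cut off by a coordinate halfspace contained in such a complement. *)
Lemma depth_region_bounded (R : realType) (d : nat)
    (mu : {finite_measure set (borelRd R d) -> \bar R}) (a : \bar R) :
  (0 < a)%E -> bounded_set (depth_region mu a).
Proof.
move=> a0.
pose E n : set 'rV[R]_d := [set y | n%:R <= `|y|].
have mE n : measurable (E n : set (borelRd R d)).
  apply: measurable_closed_borel.
  apply: (@closed_comp _ _ (fun x : 'rV[R]_d => `|x|) [set r | n%:R <= r]).
    by move=> x _; exact: norm_continuous.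
  exact: closed_ge.
have EE : \bigcap_n E n = set0.
  apply/seteqP; split=> // y Ey.
  near \oo => n; have := Ey n I; rewrite /E /= leNgt => /negP; apply.
  by near: n; exact: nbhs_infty_gtr.
have niE : nonincreasing_seq E.
  by move=> m n mn; apply/subsetPset => y; apply: le_trans; rewrite ler_nat.
have muE : mu \o E @ \oo --> mu set0.
  rewrite -EE; apply: nonincreasing_cvg_mu => //.
    by rewrite ltey_eq fin_num_measure.
  by rewrite EE.
have [n an] : exists n, (mu (E n) < a)%E.
  near \oo => n; exists n.
  by near: n; apply: near_ereal_lt muE _; rewrite measure0.
apply: (@bounded_ball0 _ _ _ n%:R) => x xa.
apply: mx_norm_le => // i; rewrite leNgt; apply/negP => nx.
pose u : 'rV[R]_d := Num.sg (x ord0 i) *: delta_mx ord0 i.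
have yu y : dotp y u = Num.sg (x ord0 i) * y ord0 i.
  rewrite /dotp (bigD1 i)//= big1 ?addr0 => [|j ji].
    by rewrite !mxE !eqxx mulr1 mulrC.
  by rewrite !mxE eqxx (negbTE ji) !mulr0.
have x0 : x ord0 i != 0 by rewrite -normr_gt0 (le_lt_trans _ nx).
have uu : unit_sphere u.
  apply/unit_sphereE; rewrite yu !mxE !eqxx mulr1.
  by rewrite -expr2 sqr_sg x0.
have : (depth mu x < a)%E.
  apply: le_lt_trans an.
  apply: (le_trans (@depth_le_halfspace _ _ mu x x u uu (halfspacexx x u))).
  apply: le_measure; rewrite ?inE//.
    exact: measurable_halfspace.
  move=> y; rewrite /halfspace/= !yu -normrEsg => xy; rewrite /E/=.
  apply: le_trans (coord_norm_le y i); apply: (le_trans (ltW nx)).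
  apply: (le_trans xy); apply: (le_trans (ler_norm _)).
  by rewrite normrM normr_sg x0 mul1r.
by rewrite ltNge => /negP; apply.
Unshelve. all: by end_near.
Qed.

Lemma compact_depth_region (R : realType) (d : nat)
    (mu : {finite_measure set (borelRd R d) -> \bar R}) (a : \bar R) :
  (0 < a)%E -> compact (depth_region mu a).
Proof.
move=> a0; apply: bounded_closed_compact; first exact: depth_region_bounded.
exact: closed_depth_region.
Qed.

Lemma depth_ge0 (R : realType) (d : nat)
    (mu : {finite_measure set (borelRd R d) -> \bar R}) (x : 'rV[R]_d) :
  (0 <= depth mu x)%E.
Proof. by apply: le_ereal_inf_tmp => _ [H _ <-]; exact: measure_ge0. Qed.

(** The supremum defining the maximal depth ranges over real levels, so that a
    depth counts as one of them only when it is finite; it is infinite when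
    there are no unit vectors, that is, in dimension 0. *)
Lemma depth_le_max (R : realType) (d : nat)
    (mu : {finite_measure set (borelRd R d) -> \bar R}) (x : 'rV[R]_d) :
  (depth mu x < +oo)%E -> (depth mu x <= max_depth mu)%E.
Proof.
move=> xoo; have xf : depth mu x \is a fin_num.
  by rewrite ge0_fin_numE// depth_ge0.
apply: ereal_sup_ubound; exists (fine (depth mu x)); last exact: fineK.
by exists x; rewrite /depth_region/= fineK.
Qed.

(** The nonempty depth regions form a chain of closed sets, compact at positive
    levels, so they have a common point; that point is in the median set. *)
Lemma median_set_nonempty (R : realType) (d : nat)
    (mu : {finite_measure set (borelRd R d) -> \bar R}) :
  (0 < max_depth mu)%E -> median_set mu !=set0.
Proof.
case/ereal_sup_gt => _ [a0 [x0 x0a] <-] a0_gt0.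
pose levels : set R := [set a | depth_region mu a%:E !=set0].
pose F := filter_from levels (fun a => depth_region mu a%:E).
have FF : ProperFilter F.
  apply: filter_from_proper; last by [].
  apply: filter_from_filter; first by exists a0, x0.
  move=> a b [x xa] [y yb]; exists (Num.max a b).
    case: (leP a b) => ab; first by exists y.
    by exists x.
  move=> z; rewrite /depth_region/= EFin_max ge_max => /andP[az bz].
  by split.
have FD : F (depth_region mu a0%:E) by exists a0 => //; exists x0.
have [p [_ Fp]] := compact_depth_region a0_gt0 FF FD.
exists p; apply: ge_ereal_sup => _ [a la <-].
apply: closed_depth_region => B pB; apply: Fp => //.
by exists a.
Qed.

(** * Limits of light halfspaces *)

(** The hypothesis says that (b, w) is a limit of pairs (b + t w', w') whose
    first component has left the depth region.  If no unit u were suitable,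
    each u would violate one of the last three conclusions strictly; that
    violation persists for nearby normals and nearby pairs, and compactness of
    the sphere makes it uniform in the normal.  This contradicts the existence
    of a light halfspace at some b + t w' close to b. *)
Lemma limit_halfspace (R : realType) (d : nat)
    (mu : {finite_measure set (borelRd R d) -> \bar R}) (a : \bar R)
    (b w : 'rV[R]_d) :
  depth_region mu a b ->
  (forall V, nbhs (b, w) V -> exists t w',
    [/\ 0 < t, V (b + t *: w', w') & (depth mu (b + t *: w')%R < a)%E]) ->
  exists u, [/\ unit_sphere u, 0 <= dotp w u,
    forall z, depth_region mu a z -> dotp z u <= dotp b u &
    (mu (open_halfspace b u) <= a)%E].
Proof.
move=> ba esc; apply: contrapT => nou.
(* The strict form of the three conclusions, which the halfspaces witnessing
   that b + t w' is shallow do satisfy; p stands for the pair (b + t w', w'). *)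
pose bad (p : 'rV[R]_d * 'rV[R]_d) v :=
  [/\ 0 < dotp p.2 v, forall z, depth_region mu a z -> dotp z v < dotp p.1 v &
    (mu (halfspace p.1 v) < a)%E].
have : near_covering (@unit_sphere R d).
  by apply/compact_near_coveringP; exact: compact_sphere.
move=> /(_ _ (nbhs (b, w)) (fun p v => ~ bad p v) _) sphere_cover.
have {sphere_cover} : \forall p \near (b, w),
    @unit_sphere R d `<=` (fun v => ~ bad p v).
  apply: sphere_cover => u uu.
  pose G := filter_prod (nbhs u) (nbhs (b, w)).
  have GF : Filter G by exact: filter_prod_filter.
  have G1 : (fun q => q.1) @ G --> u by exact: cvg_fst.
  have G21 : (fun q => q.2.1) @ G --> b.
    exact: (cvg_comp snd fst cvg_snd cvg_fst).
  have G22 : (fun q => q.2.2) @ G --> w.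
    exact: (cvg_comp snd snd cvg_snd cvg_snd).
  have cG (z : 'rV[R]_d) :
      (fun _ : 'rV[R]_d * ('rV[R]_d * 'rV[R]_d) => z) @ G --> z.
    exact: cvg_cst.
  have [wu|wu] := ltP (dotp w u) 0.
    (* Write 0 as <0, v> so that both sides are inner products. *)
    have /= := @near_dotp_lt R d _ G GF _ _ _ _ _ _ _ _ G22 G1 (cG 0) G1.
    rewrite -(scale0r (0 : 'rV[R]_d)) !dotpZl !mul0r => /(_ wu).
    apply: filterS => q; rewrite dotpZl mul0r => q0 [].
    by move=> /lt_trans /(_ q0); rewrite ltxx.
  have [[z [za zu]]|noz] :=
    pselect (exists z, depth_region mu a z /\ dotp b u < dotp z u).
    have := @near_dotp_lt R d _ G GF _ _ _ _ _ _ _ _ G21 G1 (cG z) G1 zu.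
    apply: filterS => q q0 [_ /(_ z za) + _].
    by move=> /(lt_trans q0); rewrite ltxx.
  have [ua|ua] := leP (mu (open_halfspace b u)) a.
    exfalso; apply: nou; exists u; split => // z za.
    by rewrite leNgt; apply/negP => zu; apply: noz; exists z.
  have := open_halfspace_measure_lsc ua.
  move/(cvg_pair G21 G1).
  move=> H; apply: (@filterS _ G GF _ _ _ H) => q /= qa [_ _].
  by move/(lt_trans qa); rewrite ltxx.
move=> /esc[t [w' [t0 good xa]]].
have [v vv va] := depth_lt xa.
apply: (good v vv).
have za z : depth_region mu a z -> dotp z v < dotp (b + t *: w') v.
  rewrite /depth_region/= => za; rewrite ltNge; apply/negP => bz.
  have := le_trans za (@depth_le_halfspace _ _ mu _ _ _ vv bz).
  by rewrite leNgt va.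
(* Applied to b itself, disjointness from the region gives t <w', v> > 0. *)
split => //=; have := za b ba.
by rewrite dotpDl dotpZl ltrDl pmulr_rgt0.
Qed.

(** The infimum defining the depth need not be attained by closed halfspaces,
    since their mass may jump up in the limit.  The limit of a minimizing
    sequence of normals still satisfies the bound for the open halfspace. *)
Lemma depth_open_attained (R : realType) (d : nat)
    (mu : {finite_measure set (borelRd R d) -> \bar R}) (x : 'rV[R]_d) :
  (depth mu x < +oo)%E ->
  exists2 u, unit_sphere u & (mu (open_halfspace x u) <= depth mu x)%E.
Proof.
move=> xoo; apply: contrapT => nou.
have /fineK : depth mu x \is a fin_num by rewrite ge0_fin_numE// depth_ge0.
set r := fine _ => rE.
have : near_covering (@unit_sphere R d).
  by apply/compact_near_coveringP; exact: compact_sphere.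
move=> /(_ _ (r^'+) (fun c v => (c%:E <= mu (halfspace x v))%E) _) sphere_cover.
have {sphere_cover} : \forall c \near r^'+,
    @unit_sphere R d `<=` (fun v => (c%:E <= mu (halfspace x v))%E).
  apply: sphere_cover => u uu.
  have ru : (r%:E < mu (open_halfspace x u))%E.
    by rewrite rE ltNge; apply/negP => xu; apply: nou; exists u.
  have [c0 rc c0u] : exists2 c0, r < c0 & (c0%:E < mu (open_halfspace x u))%E.
    have muf : mu (open_halfspace x u) \is a fin_num.
      by apply: fin_num_measure; exact: measurable_open_halfspace.
    move: ru; rewrite -(fineK muf) lte_fin => ru.
    by exists ((r + fine (mu (open_halfspace x u))) / 2); rewrite ?lte_fin; lra.
  have [[A B] [/= xA uB] AB] := open_halfspace_measure_lsc c0u.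
  exists (B, [set c | c <= c0]).
    by split => //=; exact: nbhs_right_le.
  move=> [v c] [/= Bv cc]; have := AB (x, v) (conj (nbhs_singleton xA) Bv).
  by move/ltW; apply: le_trans; rewrite lee_fin.
move=> H; have [c rc cx] : exists2 c, r < c &
    forall v, unit_sphere v -> (c%:E <= mu (halfspace x v))%E.
  near r^'+ => c; exists c; first by [].
  by near: c; exact: H.
have : (c%:E <= depth mu x)%E.
  by apply: le_ereal_inf_tmp => _ [_ [v [vv ->]] <-]; exact: cx.
by rewrite -rE lee_fin leNgt rc.
Unshelve. all: by end_near.
Qed.

(** Being outside the interior is enough for points outside A to be found
    nearby, provided the direction w may be perturbed: the points b + t w' with
    w' near w fill a neighbourhood of b + t w, which cannot lie inside A. *)
Lemma escaping_directions (R : realType) (d : nat) (A : set 'rV[R]_d)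
    (b w : 'rV[R]_d) :
  (\forall t \near 0^'+, ~ interior A (b + t *: w)) ->
  forall V, nbhs (b, w) V ->
    exists t w', [/\ 0 < t, V (b + t *: w', w') & ~ A (b + t *: w')].
Proof.
move=> out V [[B W] [/= Bb Ww] BWV].
have [t [t0 tout tB]] : exists t,
    [/\ 0 < t, ~ interior A (b + t *: w) & nbhs (b + t *: w) B].
  near (0 : R)^'+ => t; exists t; split; first by [].
    by near: t.
  by near: t; exact: (line_cvg w (nbhs_interior Bb)).
apply: contrapT => noesc; apply: tout.
(* The direction w' for which b + t w' = y. *)
pose g (y : 'rV[R]_d) : 'rV[R]_d := t^-1 *: (y - b).
have gE y : b + t *: g y = y.
  by rewrite /g scalerA mulfV ?gt_eqF// scale1r addrC subrK.
have gw : g (b + t *: w) = w.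
  by rewrite /g addrAC subrr add0r scalerA mulVf ?gt_eqF// scale1r.
have gc : {for b + t *: w, continuous g}.
  apply: continuousZl_tmp; apply: continuousB; first exact: cvg_id.
  exact: cst_continuous.
rewrite -gw in Ww.
have gW := gc _ Ww.
rewrite /interior/=; near=> y; apply: contrapT => Ay; apply: noesc.
exists t, (g y); rewrite gE; split => //.
apply: BWV; split => /=; first by near: y.
by near: y; exact: gW.
Unshelve. all: by end_near.
Qed.

(** The directions allowed here include w = 0 at a boundary point b, a direction
    that leaves the region at once, and any direction whatever when the region
    has empty interior. *)
Lemma supporting_light_halfspace (R : realType) (d : nat)
    (mu : {finite_measure set (borelRd R d) -> \bar R}) (a : \bar R)
    (b w : 'rV[R]_d) :
  depth_region mu a b ->
  (\forall t \near 0^'+, ~ interior (depth_region mu a) (b + t *: w)) ->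
  exists u, [/\ unit_sphere u, 0 <= dotp w u,
    forall z, depth_region mu a z -> dotp z u <= dotp b u &
    (mu (open_halfspace b u) <= a)%E].
Proof.
move=> ba out; apply: limit_halfspace => // V /(escaping_directions out).
case=> t [w' [t0 tV ta]]; exists t, w'; split => //.
by rewrite ltNge; apply/negP.
Qed.

Lemma last_point_on_segment (R : realType) (d : nat) (A : set 'rV[R]_d)
    (z x : 'rV[R]_d) :
  closed A -> A z -> ~ A x ->
  exists2 b, A b & \forall t \near 0^'+, ~ A (b + t *: (x - b)).
Proof.
move=> clA Az Ax; pose f (t : R) := z + t *: (x - z).
have fc : continuous f.
  move=> t; apply: cvgD; first exact: cvg_cst.
  by apply: cvgZr_tmp; exact: cvg_id.
have cT : compact (`[0, 1]%classic `&` f @^-1` A).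
  apply: compact_closedI; first exact: segment_compact.
  by apply: closed_comp => // t _; exact: fc.
have T0 : (`[0, 1]%classic `&` f @^-1` A) !=set0.
  by exists 0; split; rewrite /= ?in_itv/= ?lexx ?ler01// /f scale0r addr0.
have [|s] := compact_EVT_max T0 cT (f := id).
  by apply: continuous_subspaceT => t; exact: cvg_id.
rewrite inE => -[/=]; rewrite in_itv/= => /andP[s0 s1] fs smax.
have {}s1 : s < 1.
  rewrite lt_neqAle s1 andbT; apply/eqP => sE; apply: Ax.
  by move: fs; rewrite sE /f scale1r addrC subrK.
exists (f s) => //; near=> t.
have -> : f s + t *: (x - f s) = f (s + t * (1 - s)).
  apply/rowP => i; rewrite /f !mxE; ring.
have t0 : 0 < t by [].
have t1 : t <= 1 by near: t; exact: nbhs_right_le.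
move=> fA; have : s + t * (1 - s) <= s.
  by apply: smax; rewrite inE; split => //=; rewrite in_itv/=; nra.
by nra.
Unshelve. all: by end_near.
Qed.

(** * Touching halfspaces *)

Lemma touching_halfspace_sub (R : realType) (d : nat) (A H : set 'rV[R]_d) :
  touching_halfspaces A H -> H `<=` ~` interior A.
Proof.
move=> [[x [u [uu ->]]] _ HA] y Hy Ay.
have [t [t0 tA]] : exists t, 0 < t /\ A (y + t *: u).
  near (0 : R)^'+ => t; exists t; split; first by [].
  by near: t; exact: (line_cvg u Ay).
suff : (interior (halfspace x u) `&` A) (y + t *: u) by rewrite HA.
split=> //; rewrite interior_halfspace//.
move/unit_sphereE: uu => uu.
rewrite /open_halfspace/= dotpDl dotpZl uu mulr1.
by apply: le_lt_trans Hy _; rewrite ltrDl.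
Unshelve. all: by end_near.
Qed.

Lemma supporting_halfspace_touching (R : realType) (d : nat)
    (A : set 'rV[R]_d) (b u : 'rV[R]_d) :
  A b -> unit_sphere u -> (forall z, A z -> dotp z u <= dotp b u) ->
  touching_halfspaces A (halfspace b u).
Proof.
move=> Ab uu bmax; split; first by exists b, u.
  exists b; split; first by rewrite /halfspace/=.
  exact: subset_closure.
rewrite interior_halfspace//; apply/seteqP; split=> // z [bz /bmax].
by rewrite leNgt bz.
Qed.

Lemma smooth_touching_halfspace (R : realType) (d : nat)
    (mu : {finite_measure set (borelRd R d) -> \bar R}) (A : set 'rV[R]_d)
    (x u : 'rV[R]_d) :
  smooth_at mu A -> unit_sphere u -> touching_halfspaces A (halfspace x u) ->
  mu (halfspace x u) = mu (open_halfspace x u).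
Proof.
move=> [_ sm] uu /sm bd0.
have clH := @closed_halfspace R d x u.
have -> : halfspace x u = open_halfspace x u `|` boundary (halfspace x u).
  rewrite /boundary -(proj1 (closure_id _) clH) interior_halfspace// setDUK//.
  by move=> y /ltW.
have mo : measurable (open_halfspace x u : set (borelRd R d)).
  exact: measurable_open_halfspace.
apply: measureU0 => //.
rewrite /boundary -(proj1 (closure_id _) clH) interior_halfspace//.
by apply: measurableD => //; exact: measurable_closed_borel.
Qed.

(** * Halfspaces of maximal depth touching the median set *)

Lemma depth_lt_pinfty (R : realType) (d : nat)
    (mu : {finite_measure set (borelRd R d) -> \bar R}) (x u : 'rV[R]_d) :
  unit_sphere u -> (depth mu x < +oo)%E.
Proof.
move=> uu.
apply: le_lt_trans (@depth_le_halfspace _ _ mu x x u uu (halfspacexx x u)) _.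
rewrite ltey_eq fin_num_measure//.
exact: measurable_halfspace.
Qed.

(** A point outside the median set witnesses both that some unit vector exists,
    which makes all depths finite, and that the maximal depth is positive. *)
Lemma median_proper_max_depth (R : realType) (d : nat)
    (mu : {finite_measure set (borelRd R d) -> \bar R}) :
  median_set mu `<` [set: 'rV[R]_d] ->
  (0 < max_depth mu)%E /\ forall x, (depth mu x <= max_depth mu)%E.
Proof.
move=> [_ /existsNP[x /not_implyP[_ /negP]]].
rewrite /median_set /depth_region/=.
rewrite -ltNge => xlt; split; first exact: le_lt_trans (depth_ge0 mu x) xlt.
have [u uu _] := depth_lt xlt.
by move=> y; apply: depth_le_max; exact: depth_lt_pinfty uu.
Qed.

(** Smoothness turns the bound on the open halfspace into one on the closed
    halfspace, which in turn cannot be lighter than the depth of b. *)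
Lemma touching_halfspace_max_depth (R : realType) (d : nat)
    (mu : {finite_measure set (borelRd R d) -> \bar R}) (b w : 'rV[R]_d) :
  smooth_at mu (median_set mu) -> median_set mu b ->
  (\forall t \near 0^'+, ~ interior (median_set mu) (b + t *: w)) ->
  exists u, [/\ unit_sphere u, 0 <= dotp w u,
    touching_halfspaces (median_set mu) (halfspace b u) &
    mu (halfspace b u) = max_depth mu].
Proof.
move=> sm Mb out.
have [u [uu wu bmax light]] := supporting_light_halfspace Mb out.
have touch := supporting_halfspace_touching Mb uu bmax.
exists u; split => //; apply/eqP; rewrite eq_le; apply/andP; split.
  by rewrite (smooth_touching_halfspace sm uu touch).
by apply: le_trans Mb _; apply: depth_le_halfspace => //; exact: halfspacexx.
Qed.

(** At an interior point x some open halfspace with normal u and boundary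
    through x has mass at most the depth of x, which does not exceed the maximal
    depth.  It contains a closed halfspace with boundary through an interior
    point y of the median set, which strictly contains the touching halfspace
    with normal u.  By contiguity the latter would then be lighter than the
    maximal depth, although it contains the median point z. *)
Lemma interior_median_set_contiguous (R : realType) (d : nat)
    (mu : {finite_measure set (borelRd R d) -> \bar R}) :
  contiguous_support_at mu (median_set mu) -> interior (median_set mu) = set0.
Proof.
move=> [prop contig]; have [max0 lemax] := median_proper_max_depth prop.
apply/seteqP; split=> // x intx.
have [u0 u0u _] : exists2 u : 'rV[R]_d, unit_sphere u & True.
  have [_ /existsNP[y /not_implyP[_ /negP]]] := prop.
  by rewrite -ltNge => /depth_lt[v vv _]; exists v.
have [u uu light] := depth_open_attained (depth_lt_pinfty mu x u0u).
have /unit_sphereE uu1 := uu.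
have Mx : median_set mu x by exact: interior_subset.
have [|z Mz zmax] := @compact_EVT_max _ R (fun y => dotp y u) _
    (ex_intro _ x Mx) (compact_depth_region max0).
  by apply: continuous_subspaceT => y; exact: dotp_continuousl.
rewrite inE in Mz.
have {}zmax y : median_set mu y -> dotp y u <= dotp z u.
  by move=> My; apply: zmax; rewrite inE.
(* The boundary of the intermediate halfspace goes through y = x + t u; the
   further step s keeps y away from the touching hyperplane at z. *)
have [t [t0 intt]] : exists t, 0 < t /\ interior (median_set mu) (x + t *: u).
  near (0 : R)^'+ => t; exists t; split; first by [].
  by near: t; exact: (line_cvg u (nbhs_interior intx)).
pose y := x + t *: u; rewrite -/y in intt.
have [s [s0 Ms]] : exists s, 0 < s /\ median_set mu (y + s *: u).
  near (0 : R)^'+ => s; exists s; split; first by [].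
  by near: s; exact: (line_cvg u intt).
have yz : dotp y u < dotp z u.
  by apply: lt_le_trans (zmax _ Ms); rewrite dotpDl dotpZl uu1 mulr1 ltrDl.
have xy : dotp x u < dotp y u by rewrite dotpDl dotpZl uu1 mulr1 ltrDl.
have touch := supporting_halfspace_touching Mz uu zmax.
have : (mu (halfspace z u) < mu (halfspace y u))%E.
  apply: contig => //; first by exists y, u.
    split=> [v|]; first exact: le_trans (ltW yz).
    by move=> /(_ y (halfspacexx y u)); rewrite /halfspace/= leNgt yz.
  exists y; split=> //; split.
    by apply: subset_closure; exact: halfspacexx.
  by rewrite interior_halfspace// /open_halfspace/= ltxx.
rewrite ltNge => /negP; apply.
apply: (@le_trans _ _ (depth mu z)); last first.
  by apply: depth_le_halfspace => //; exact: halfspacexx.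
apply: le_trans Mz; apply: le_trans (lemax x); apply: le_trans light.
apply: le_measure; rewrite ?inE.
- exact: measurable_halfspace.
- exact: measurable_open_halfspace.
- by move=> v; exact: lt_le_trans.
Unshelve. all: by end_near.
Qed.

Theorem corollary8 (R : realType) (d : nat)
    (mu : {finite_measure set (borelRd R d) -> \bar R})
    (mu_smooth : smooth_at mu (median_set mu)) :
  ~` interior (median_set mu) =
    \bigcup_(H in [set H | touching_halfspaces (median_set mu) H /\
                           mu H = max_depth mu]) H /\
  (contiguous_support_at mu (median_set mu) ->
   forall x : 'rV[R]_d, median_set mu x ->
     [set: 'rV[R]_d] =
       \bigcup_(H in [set H | halfspaces_at x H /\ mu H = depth mu x]) H).
Proof.
have [max0 lemax] := median_proper_max_depth (proj1 mu_smooth).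
split; first (apply/seteqP; split; last first).
- by move=> x [H [touch _]]; exact: touching_halfspace_sub.
- move=> x intx.
  have [b Mb out] : exists2 b, median_set mu b &
      \forall t \near 0^'+, ~ interior (median_set mu) (b + t *: (x - b)).
    have [Mx|Mx] := pselect (median_set mu x).
      (* For b = x the direction is 0, and the ray stays at x. *)
      exists x => //; rewrite subrr; near=> t.
      by rewrite scaler0 addr0.
    have [z Mz] := median_set_nonempty max0.
    have clM := @closed_depth_region _ _ mu (max_depth mu).
    have [b Mb out] := last_point_on_segment clM Mz Mx.
    exists b => //; near=> t => /interior_subset; near: t; exact: out.
  have [u [uu xb touch muH]] := touching_halfspace_max_depth mu_smooth Mb out.
  by exists (halfspace b u) => //; move: xb; rewrite dotpBl subr_ge0.
(* All directions at x are allowed since the median set has no interior. *)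
move=> contig x Mx; apply/esym; rewrite -subTset => y _.
have int0 := interior_median_set_contiguous contig.
have [|u [uu xy _ muH]] :=
  @touching_halfspace_max_depth _ _ mu x (y - x) mu_smooth Mx.
  by near=> t; rewrite int0.
exists (halfspace x u); last by move: xy; rewrite dotpBl subr_ge0.
split; first by exists u.
by rewrite muH; apply/eqP; rewrite eq_le lemax andbT.
Unshelve. all: by end_near.
Qed.
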